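(* Let $X\subset\mathbb{R}^n$ and $p\in\overline{X}$, and suppose that $X$ has a unique tangent cone at $p$. Let $\Lambda=(\lambda_i)_{i\in\mathbb{N}}$ be a sequence of positive real numbers tending to infinity and let $\omega$ be a non-principal ultrafilter on $\mathbb{N}$. Then the map $$\Phi:(X_{\omega,\Lambda,p},d_{out,\omega})\to(C(X,p),d_{out}),\qquad \Phi([(x_i)])=\lim_\omega\lambda_i(x_i-p),$$ is an isometry (that is, a surjective distance-preserving map).
   Context: $d_{out}$ denotes the metric induced by the Euclidean distance. Tangent cones: for a sequence $\Lambda=(\lambda_i)$ of positive reals tending to $\infty$, $C(X,\Lambda,p)=\{v\in\mathbb{R}^n:\exists(x_i)\subset X,\ x_i\to p,\ \lim_{i\to\infty}\lambda_i(x_i-p)=v\}$. $X$ has a unique tangent cone at $p$ if $C(X,\Lambda,p)$ does not depend on $\Lambda$. Further, $C(X,p)=\{v\in\mathbb{R}^n:\exists(x_i)\subset X,\ x_i\to p,\ \exists(\lambda_i)\subset\mathbb{R}_+,\ \lambda_i\to\infty,\ v=\lim_{i\to\infty}\lambda_i(x_i-p)\}$; when the tangent cone is unique, $C(X,\Lambda,p)=C(X,p)$ for all $\Lambda$. Ultralimits and blow-up: $\lim_\omega a_i=a$ means $\{i:a_i\in W\}\in\omega$ for every neighbourhood $W$ of $a$; it exists and is unique for bounded sequences in $\mathbb{R}^k$. The blow-up $X_{\omega,\Lambda,p}$ (for $X$ with the outer metric) is the set of sequences $(x_i)$ in $X$ with $\sup_i\lambda_i\|x_i-p\|<\infty$,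 modulo the relation $d_{out,\omega}=0$, where $d_{out,\omega}((x_i),(y_i))=\lim_\omega\lambda_i\|x_i-y_i\|$, endowed with the metric induced by $d_{out,\omega}$; $[(x_i)]$ denotes the class of $(x_i)$. *)

(* Defs.v *)
From HB Require Import structures.
From mathcomp Require Import all_boot all_order all_algebra generic_quotient.
From mathcomp Require Import all_classical all_reals.
From mathcomp Require Import ereal topology normedtype sequences.
From mathcomp Require Import ring.

Set Implicit Arguments.
Unset Strict Implicit.
Unset Printing Implicit Defensive.

Import Order.TTheory GRing.Theory Num.Theory.
Import numFieldNormedType.Exports.

Local Open Scope classical_set_scope.
Local Open Scope ring_scope.
Local Open Scope quotient_scope.

(* The library norm on 'rV[R]_n is the sup norm. It induces the usual topology
   of R^n, which is the one used below for limits and closures, but not the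
   Euclidean distance. *)
Definition enorm (R : realType) (n : nat) (v : 'rV[R]_n) : R :=
  Num.sqrt (\sum_(i < n) v ord0 i ^+ 2).

Definition d_out (R : realType) (n : nat) (v w : 'rV[R]_n) : R := enorm (v - w).

Record scaling (R : realType) := Scaling {
  scaling_fun :> nat -> R ;
  scaling_gt0 : forall i, 0 < scaling_fun i ;
  scaling_dvg : scaling_fun @ \oo --> +oo }.

Definition tangent_cone_along (R : realType) (n : nat) (X : set 'rV[R]_n)
    (L : scaling R) (p : 'rV[R]_n) : set 'rV[R]_n :=
  [set v | exists x : nat -> 'rV[R]_n,
    [/\ forall i, X (x i), x @ \oo --> p &
        (fun i => L i *: (x i - p)) @ \oo --> v]].

Definition tangent_cone (R : realType) (n : nat) (X : set 'rV[R]_n)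
    (p : 'rV[R]_n) : set 'rV[R]_n :=
  [set v | exists x : nat -> 'rV[R]_n, exists L : scaling R,
    [/\ forall i, X (x i), x @ \oo --> p &
        (fun i => L i *: (x i - p)) @ \oo --> v]].

Definition unique_tangent_cone (R : realType) (n : nat) (X : set 'rV[R]_n)
    (p : 'rV[R]_n) : Prop :=
  forall L L' : scaling R, tangent_cone_along X L p = tangent_cone_along X L' p.

Definition blowup_seq (R : realType) (n : nat) (X : set 'rV[R]_n)
    (L : scaling R) (p : 'rV[R]_n) : set (nat -> 'rV[R]_n) :=
  [set x | (forall i, X (x i)) /\
           has_ubound (range (fun i => L i * enorm (x i - p)))].

Definition d_out_omega (R : realType) (n : nat) (L : scaling R)
    (omega : set_system nat) (x y : nat -> 'rV[R]_n) : R :=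
  lim ((fun i => L i * d_out (x i) (y i)) @ omega).

Section euclidean_norm.
Variables (R : realType) (n : nat).
Implicit Types u v w : 'rV[R]_n.

Lemma enorm_ge0 v : 0 <= enorm v.
Proof. exact: sqrtr_ge0. Qed.

Lemma enorm_sqr v : enorm v ^+ 2 = \sum_(i < n) v ord0 i ^+ 2.
Proof. by rewrite sqr_sqrtr// sumr_ge0// => i _; exact: sqr_ge0. Qed.

Lemma enorm0 : enorm (0 : 'rV[R]_n) = 0.
Proof.
by rewrite /enorm big1 ?sqrtr0// => i _; rewrite mxE expr0n.
Qed.

Lemma enormN v : enorm (- v) = enorm v.
Proof. by rewrite /enorm; under eq_bigr do rewrite mxE sqrrN. Qed.

Lemma enorm0_eq0 v : enorm v = 0 -> v = 0.
Proof.
move=> v0; have /eqP := enorm_sqr v; rewrite v0 expr0n/= eq_sym.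
rewrite psumr_eq0; last by move=> i _; exact: sqr_ge0.
move=> /allP h; apply/rowP => i; rewrite mxE.
by have := h i (mem_index_enum i); rewrite sqrf_eq0 => /eqP.
Qed.

Lemma enorm_dot_le u v :
  \sum_(i < n) u ord0 i * v ord0 i <= enorm u * enorm v.
Proof.
have [u0|u0] := eqVneq (enorm u) 0.
  rewrite u0 mul0r (enorm0_eq0 u0) big1// => i _; by rewrite mxE mul0r.
have [v0|v0] := eqVneq (enorm v) 0.
  rewrite v0 mulr0 (enorm0_eq0 v0) big1// => i _; by rewrite mxE mulr0.
set a := enorm u; set b := enorm v; set s := \sum_(i < n) _.
have ap : 0 < a by rewrite lt_neqAle eq_sym u0 enorm_ge0.
have bp : 0 < b by rewrite lt_neqAle eq_sym v0 enorm_ge0.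
have : 0 <= \sum_(i < n) (b * u ord0 i - a * v ord0 i) ^+ 2.
  by apply: sumr_ge0 => i _; exact: sqr_ge0.
have -> : \sum_(i < n) (b * u ord0 i - a * v ord0 i) ^+ 2 =
    (a * b *+ 2) * (a * b - s).
  under eq_bigr => i _.
    rewrite (_ : _ ^+ 2 = b ^+ 2 * u ord0 i ^+ 2 -
      (a * b *+ 2) * (u ord0 i * v ord0 i) + a ^+ 2 * v ord0 i ^+ 2); last by ring.
  over.
  rewrite big_split/= sumrB -!mulr_sumr -!enorm_sqr -/a -/b -/s; ring.
by rewrite pmulr_rge0 ?subr_ge0// pmulrn_lgt0// mulr_gt0.
Qed.

Lemma enormD u v : enorm (u + v) <= enorm u + enorm v.
Proof.
rewrite -(@ler_pXn2r _ 2)// ?nnegrE ?addr_ge0 ?enorm_ge0//.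
rewrite sqrrD !enorm_sqr; under eq_bigr do rewrite mxE sqrrD.
rewrite !big_split/= lerD2r lerD2l. rewrite -mulr2n lerMn2r/=.
exact: enorm_dot_le.
Qed.

Lemma d_outxx v : d_out v v = 0.
Proof. by rewrite /d_out subrr enorm0. Qed.

Lemma d_out_ge0 v w : 0 <= d_out v w.
Proof. exact: enorm_ge0. Qed.

Lemma d_out_sym v w : d_out v w = d_out w v.
Proof. by rewrite /d_out -enormN opprB. Qed.

Lemma d_out_triangle w u v : d_out u v <= d_out u w + d_out w v.
Proof. by rewrite /d_out -(subrKA w u) enormD. Qed.

End euclidean_norm.

Section blowup_quotient.
Variables (R : realType) (n : nat) (X : set 'rV[R]_n) (L : scaling R).
Variables (p : 'rV[R]_n) (omega : set_system nat).
Hypothesis Uomega : UltraFilter omega.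
Local Notation seqs := (blowup_seq X L p).
Implicit Types x y z : seqs.

Lemma ultra_cvg_real (u : nat -> R) (M : R) :
  (forall i, 0 <= u i <= M) -> cvg (u @ omega).
Proof.
move=> uM; have := @segment_compact R 0 M.
rewrite compact_ultra => /(_ (u @ omega)) h.
have uU : UltraFilter (u @ omega).
  split; first exact: fmap_proper_filter.
  move=> G GP sG; apply/seteqP; split => // A GA.
  have [//|nA] := in_ultra_setVsetC (u @^-1` A) Uomega.
  have /sG GC : (u @ omega) (~` A) by [].
  have : G (A `&` ~` A) by exact: filterI.
  by rewrite setICr => G0; have := @filter_not_empty _ G GP G0.
have [|l [_ ul]] := h uU; last by apply/cvg_ex; exists l.
suff : omega (u @^-1` `[0, M]) by [].
by apply: filterE => i /=; rewrite in_itv/=; exact: uM.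
Qed.

Lemma d_out_omega_is_cvg x y :
  (fun i => L i * d_out (val x i) (val y i)) @ omega -->
  d_out_omega L omega (val x) (val y).
Proof.
have /set_mem[_ [Mx hx]] := valP x; have /set_mem[_ [My hy]] := valP y.
apply: (@ultra_cvg_real _ (Mx + My)) => i; have Li := ltW (scaling_gt0 L i).
rewrite mulr_ge0//= ?d_out_ge0//.
apply: (@le_trans _ _ (L i * d_out (val x i) p + L i * d_out p (val y i))).
  by rewrite -mulrDr ler_wpM2l// d_out_triangle.
rewrite (d_out_sym p); apply: lerD; [apply: hx|apply: hy]; by exists i.
Qed.
Arguments d_out_omega_is_cvg : clear implicits.

Lemma d_out_omegaxx x : d_out_omega L omega (val x) (val x) = 0.
Proof.
rewrite /d_out_omega; under eq_fun do rewrite d_outxx mulr0.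
exact: (cvg_lim _ (@cvg_cst _ _ _ _ _)).
Qed.

Lemma d_out_omega_sym x y :
  d_out_omega L omega (val x) (val y) = d_out_omega L omega (val y) (val x).
Proof. by rewrite /d_out_omega; under eq_fun do rewrite d_out_sym. Qed.

Lemma d_out_omega_ge0 x y : 0 <= d_out_omega L omega (val x) (val y).
Proof.
apply: (cvgr_to_ge (d_out_omega_is_cvg x y)).
by apply: filterE => i; rewrite mulr_ge0 ?d_out_ge0// ltW// scaling_gt0.
Qed.

Lemma d_out_omega_triangle y x z :
  d_out_omega L omega (val x) (val z) <=
  d_out_omega L omega (val x) (val y) + d_out_omega L omega (val y) (val z).
Proof.
rewrite -subr_ge0.
have h := cvgB (cvgD (d_out_omega_is_cvg x y) (d_out_omega_is_cvg y z))
  (d_out_omega_is_cvg x z).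
apply: (cvgr_to_ge (h _ _)); apply: filterE => i /=.
rewrite !fctE subr_ge0 -mulrDr ler_wpM2l ?d_out_triangle//.
by rewrite ltW// scaling_gt0.
Qed.

Definition blowup_rel x y : bool :=
  `[< d_out_omega L omega (val x) (val y) = 0 >].

Lemma blowup_rel_refl : reflexive blowup_rel.
Proof. by move=> x; apply/asboolP; exact: d_out_omegaxx. Qed.

Lemma blowup_rel_sym : symmetric blowup_rel.
Proof. by move=> x y; rewrite /blowup_rel d_out_omega_sym. Qed.

Lemma blowup_rel_trans : transitive blowup_rel.
Proof.
move=> y x z /asboolP xy /asboolP yz; apply/asboolP/eqP.
rewrite eq_le d_out_omega_ge0 andbT.
by rewrite (le_trans (d_out_omega_triangle y x z))// xy yz addr0.
Qed.

Canonical blowup_equiv :=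
  EquivRel blowup_rel blowup_rel_refl blowup_rel_sym blowup_rel_trans.

Definition blowup : Type := {eq_quot blowup_rel}.

HB.instance Definition _ := Choice.on blowup.
HB.instance Definition _ := EqQuotient.on blowup.

Definition blowup_class (x : seqs) : blowup := \pi_blowup x.

Definition blowup_dist (a b : blowup) : R :=
  d_out_omega L omega (val (repr a)) (val (repr b)).

Lemma blowup_repr x :
  d_out_omega L omega (val (repr (blowup_class x))) (val x) = 0.
Proof.
apply/asboolP; rewrite -[`[< _ >]]/(blowup_rel _ _).
rewrite -(@pi_eq_quot _ _ blowup) /blowup_class reprK; exact/eqP.
Qed.

Lemma blowup_dist_class x y :
  blowup_dist (blowup_class x) (blowup_class y) =
  d_out_omega L omega (val x) (val y).
Proof.
rewrite /blowup_dist; set x' := repr _; set y' := repr _.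
have hx : d_out_omega L omega (val x') (val x) = 0 by exact: blowup_repr.
have hy : d_out_omega L omega (val y') (val y) = 0 by exact: blowup_repr.
apply/eqP; rewrite eq_le; apply/andP; split.
  rewrite (le_trans (d_out_omega_triangle x x' y'))// hx add0r.
  rewrite (le_trans (d_out_omega_triangle y x y'))//.
  by rewrite (d_out_omega_sym y) hy addr0.
rewrite (le_trans (d_out_omega_triangle x' x y))// (d_out_omega_sym x) hx add0r.
by rewrite (le_trans (d_out_omega_triangle y' x' y))// hy addr0.
Qed.

Lemma blowup_distxx a : blowup_dist a a = 0.
Proof. exact: d_out_omegaxx. Qed.

Lemma blowup_dist_positivity a b : blowup_dist a b = 0 -> a = b.
Proof.
move=> ab; rewrite -[a]reprK -[b]reprK; apply/eqP.
by rewrite pi_eq_quot; apply/asboolP.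
Qed.

Lemma blowup_dist_sym a b : blowup_dist a b = blowup_dist b a.
Proof. exact: d_out_omega_sym. Qed.

Lemma blowup_dist_triangle b a c :
  blowup_dist a c <= blowup_dist a b + blowup_dist b c.
Proof. exact: d_out_omega_triangle. Qed.

HB.instance Definition _ := @isMetric.Build R blowup blowup_dist
  blowup_distxx blowup_dist_positivity blowup_dist_sym blowup_dist_triangle.

Lemma mdist_blowup_class x y :
  mdist (blowup_class x) (blowup_class y) = d_out_omega L omega (val x) (val y).
Proof. exact: blowup_dist_class. Qed.

(* Defined on the canonical representative of a class; independence of the
   representative is not assumed here. *)
Definition Phi (a : blowup) : 'rV[R]_n :=
  lim ((fun i => L i *: (val (repr a) i - p)) @ omega).

End blowup_quotient.

Arguments blowup {R n} X L p omega {Uomega}.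
Arguments blowup_class {R n X L p omega Uomega} x.
Arguments Phi {R n X L p omega Uomega} a.

(* C carries the restriction of d_out. *)
Definition isometry_onto (R : realType) (T : metricType R) (n : nat)
    (f : T -> 'rV[R]_n) (C : set 'rV[R]_n) : Prop :=
  (forall a b : T, d_out (f a) (f b) = mdist a b) /\ range f = C.

(* Main.v *)
(* By uniqueness, C(X,p) is the tangent cone along Lambda. A vector of it is
   hit by the class of any sequence realising it, because a non-principal
   ultrafilter refines the filter of cofinite sets. Conversely an
   omega-limit of Lambda_i (x_i - p) is an ordinary limit along a choice of
   indices k_0, k_1, ... with k_j >= j, hence lies in C(X,p). Distances are
   preserved because the Euclidean norm is continuous. *)
Require Import Defs.
From mathcomp Require Import all_boot all_order all_algebra.
From mathcomp Require Import all_classical all_reals.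
From mathcomp Require Import ereal topology normedtype sequences.
From mathcomp Require Import function_spaces realfun.

Set Implicit Arguments.
Unset Strict Implicit.
Unset Printing Implicit Defensive.

Import Order.TTheory GRing.Theory Num.Theory.
Import numFieldNormedType.Exports.

Local Open Scope classical_set_scope.
Local Open Scope ring_scope.

Lemma ultra_set1_principal (T : Type) (F : set_system T) (t : T) :
  UltraFilter F -> F [set t] -> F = principal_filter t.
Proof.
move=> FU Ft; apply/seteqP; split=> A.
  move=> FA; apply/principal_filterP.
  by have [_ [-> //]] := filter_ex (filterI Ft FA).
by move/principal_filterP => At; apply: filterS Ft => _ ->.
Qed.

(** Induction on the start [N] of the tail: [F] contains [[set N]], which would make it principal,
    or its complement, which removes [N] from the tail. *)
Lemma nonprincipal_ultra_cofinite (F : set_system nat) : UltraFilter F ->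
  (forall k, F <> principal_filter k) -> \oo `<=` F.
Proof.
move=> FU Fk A [N _ NA]; apply: (filterS NA) => {A NA}.
elim: N => [|N IHN]; first by apply: filterE => i /=.
have [/(ultra_set1_principal FU)/Fk//|FN] := in_ultra_setVsetC [set N] FU.
apply: filterS (filterI IHN FN) => i [/= Ni /eqP iN].
by rewrite ltn_neqAle eq_sym iN.
Qed.

(** A neighbourhood of a matrix contains a product of neighbourhoods of its finitely many
    entries. *)
Lemma cvg_mx (T : topologicalType) (I : Type) (F : set_system I) (m n : nat)
    (f : I -> 'M[T]_(m, n)) (M : 'M[T]_(m, n)) : Filter F ->
  (forall i j, (fun t => f t i j) @ F --> M i j) -> f @ F --> M.
Proof.
move=> FF fM A [P MP PA].
have : \forall t \near F, forall i j, P i j (f t i j).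
  by apply: filter_forall => i; apply: filter_forall => j; apply: fM; exact: MP.
by apply: filterS => t Pt; exact: PA.
Qed.

Section euclidean_norm_topology.
Variables (R : realType) (n : nat).
Implicit Types v : 'rV[R]_n.

Lemma enorm_continuous : continuous (@enorm R n).
Proof.
have sqr_cont : continuous (fun w : 'rV[R]_n => \sum_(i < n) w ord0 i ^+ 2).
  apply: (@continuous_big _ _ +%R) => [|i _ w]; first exact: add_continuous.
  by apply: (@cvgM _ _ (nbhs w)); exact: coord_continuous.
by move=> v; exact: cvg_comp (sqr_cont v) (@sqrt_continuous R _).
Qed.

Lemma coord_le_enorm v i : `|v ord0 i| <= enorm v.
Proof.
rewrite -sqrtr_sqr ler_wsqrtr// (bigD1 i)//= lerDl sumr_ge0// => j _.
exact: sqr_ge0.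
Qed.

Lemma enormZ (a : R) v : 0 <= a -> enorm (a *: v) = a * enorm v.
Proof.
move=> a0; rewrite /enorm; under eq_bigr do rewrite mxE exprMn.
by rewrite -mulr_sumr sqrtrM ?sqr_ge0// sqrtr_sqr ger0_norm.
Qed.

Lemma ultra_enorm_bounded_cvg (F : set_system nat) (u : nat -> 'rV[R]_n)
    (M : R) : UltraFilter F -> (forall i, enorm (u i) <= M) -> cvg (u @ F).
Proof.
move=> FU uM.
have cu i : cvg ((fun k => u k ord0 i) @ F).
  (* Adding [M] moves the coordinate from [[-M, M]] into [[0, M + M]], where compactness gives an
     ultralimit. *)
  have /cvg_ex[l ul] : cvg ((fun k => u k ord0 i + M) @ F).
    apply: (@ultra_cvg_real _ _ FU _ (M + M)) => k.
    have := le_trans (coord_le_enorm (u k) i) (uM k).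
    by rewrite ler_norml -(lerD2r M) addNr => /andP[-> ?]; rewrite lerD2r.
  apply/cvg_ex; exists (l - M).
  apply: cvg_trans (cvgB ul (cvg_cst M)); apply: near_eq_cvg.
  by apply: nearW => k /=; rewrite !fctE addrK.
apply/cvg_ex; exists (\row_i lim ((fun k => u k ord0 i) @ F)).
by apply: cvg_mx => i j; rewrite ord1 mxE; exact: cu.
Qed.

End euclidean_norm_topology.

Section blowup_limits.
Variables (R : realType) (n : nat) (X : set 'rV[R]_n) (p : 'rV[R]_n).
Variables (L : scaling R) (omega : set_system nat).
Hypothesis Uomega : UltraFilter omega.
Local Notation zoom x := (fun i => L i *: (x i - p)).

Lemma enorm_zoom (x : nat -> 'rV[R]_n) i :
  enorm (L i *: (x i - p)) = L i * enorm (x i - p).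
Proof. by rewrite enormZ// ltW// scaling_gt0. Qed.

Lemma zoom_is_cvg (x : blowup_seq X L p) : cvg (zoom (val x) @ omega).
Proof.
have /set_mem[_ [M xM]] := valP x.
apply: (@ultra_enorm_bounded_cvg _ _ _ _ M) => i.
by rewrite enorm_zoom; apply: xM; exists i.
Qed.

(** The base point cancels in the difference of the two rescaled sequences, and the Euclidean norm
    is continuous. *)
Lemma d_out_omega_zoom (x y : nat -> 'rV[R]_n) (v w : 'rV[R]_n) :
  zoom x @ omega --> v -> zoom y @ omega --> w ->
  d_out_omega L omega x y = d_out v w.
Proof.
move=> xv yw; apply: cvg_lim => //.
apply: cvg_trans (cvg_comp _ _ (cvgB xv yw) (@enorm_continuous _ _ (v - w))).
apply: near_eq_cvg; apply: nearW => i /=.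
rewrite !fctE -scalerBr opprB addrA subrK enormZ//.
by rewrite ltW// scaling_gt0.
Qed.

(** Independence of the representative: equivalent sequences are at omega-distance 0, so their
    limits are at Euclidean distance 0. *)
Lemma Phi_class_cvg (x : blowup_seq X L p) :
  zoom (val x) @ omega --> (Phi (blowup_class x : blowup X L p omega)).
Proof.
have := blowup_repr Uomega x.
rewrite /Phi; set y := repr _ => yx.
have /cvg_ex[v xv] := @zoom_is_cvg x.
have yv := @zoom_is_cvg y.
rewrite (d_out_omega_zoom yv xv) in yx.
by move/enorm0_eq0/eqP : yx; rewrite subr_eq0 => /eqP ->.
Qed.

Lemma Phi_classE (x : blowup_seq X L p) (v : 'rV[R]_n) :
  zoom (val x) @ omega --> v -> Phi (blowup_class x : blowup X L p omega) = v.
Proof.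
by move=> xv; apply: (cvg_unique _ _ xv) => //; exact: Phi_class_cvg.
Qed.

Lemma ultra_cvg_tangent_cone (x : nat -> 'rV[R]_n) (v : 'rV[R]_n) :
  \oo `<=` omega -> (forall i, X (x i)) -> zoom x @ omega --> v ->
  tangent_cone X p v.
Proof.
move=> oo_omega Xx /cvgrPdist_lt xv.
(* Sets of [omega] are nonempty. The choice [g] need not be monotone: [k <= g k] already sends
   [L (g k)] to infinity. *)
have /choice[g gP] k : exists i,
    (k <= i)%N /\ `|v - L i *: (x i - p)| < k.+1%:R^-1.
  apply: (@filter_ex _ omega).
  by apply: filterI; [exact/oo_omega/nbhs_infty_ge|apply: xv; rewrite invr_gt0].
have g_oo : g @ \oo --> \oo.
  move=> A [N _ NA]; exists N => // k /= Nk; apply: NA => /=.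
  by rewrite (leq_trans Nk)//; have [] := gP k.
have Lg_oo : (fun k => L (g k)) @ \oo --> +oo.
  exact: cvg_comp g_oo (@scaling_dvg _ L).
have gv : (fun k => L (g k) *: (x (g k) - p)) @ \oo --> v.
  apply/cvgrPdist_lt => _/posnumP[e]; near=> k.
  have [_ /lt_trans->//] := gP k.
  by near: k; exact: near_infty_natSinv_lt.
exists (x \o g), (@Scaling R (fun k => L (g k))
  (fun k => scaling_gt0 L (g k)) Lg_oo); split => //=.
(* [x (g k) - p] is the inverse scale, tending to 0, times a sequence tending to [v]. *)
apply/subr_cvg0; rewrite -(scale0r v).
have LV0 : (fun k => (L (g k))^-1) @ \oo --> 0.
  by apply/gtr0_cvgV0 => //; apply: nearW => k; exact: scaling_gt0.
apply: cvg_trans (cvgZ LV0 gv); apply: near_eq_cvg; apply: nearW => k /=.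
by rewrite scalerA mulVf ?scale1r// gt_eqF// scaling_gt0.
Unshelve. all: by end_near. Qed.

Lemma tangent_cone_along_blowup (v : 'rV[R]_n) : tangent_cone_along X L p v ->
  exists x : blowup_seq X L p, zoom (val x) @ \oo --> v.
Proof.
move=> [x [Xx _ xv]].
have Bx : x \in blowup_seq X L p.
  (* The norms of the rescaled sequence converge, hence are bounded. *)
  apply/mem_set; split=> //; apply: bounded_fun_has_ubound.
  apply: cvg_seq_bounded; apply/cvg_ex; exists (enorm v).
  under eq_fun do rewrite -enorm_zoom.
  exact: cvg_comp xv (@enorm_continuous _ _ v).
by exists (SigSub Bx).
Qed.

End blowup_limits.

(** The first conjunct makes [Phi] well defined: the limit exists along every representative, so
    [lim] is never a default value. *)
Theorem proposition4p1 (R : realType) (n : nat) (X : set 'rV[R]_n)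
    (p : 'rV[R]_n) (Xp : closure X p) (Xcone : unique_tangent_cone X p)
    (Lambda : scaling R) (omega : set_system nat)
    (Uomega : UltraFilter omega)
    (nonprincipal : forall k : nat, omega <> principal_filter k) :
  (forall x : blowup_seq X Lambda p,
     (fun i => Lambda i *: (val x i - p)) @ omega -->
       (Phi (blowup_class x : blowup X Lambda p omega) : 'rV[R]_n)) /\
  isometry_onto (Phi : blowup X Lambda p omega -> 'rV[R]_n) (tangent_cone X p).
Proof.
have oo_omega := nonprincipal_ultra_cofinite Uomega nonprincipal.
split; first exact: Phi_class_cvg.
split=> [a b|].
  by apply/esym/d_out_omega_zoom; exact: zoom_is_cvg.
apply/seteqP; split=> [_ [a _ <-]|v [x [L' xv]]].
  have /set_mem[Xa _] := valP (repr a).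
  by apply: (ultra_cvg_tangent_cone Uomega oo_omega Xa); exact: zoom_is_cvg.
(* The vector comes with its own scaling [L']; uniqueness of the cone supplies another sequence
   realising it along [Lambda]. *)
have : tangent_cone_along X L' p v by exists x.
rewrite (Xcone L' Lambda) => /tangent_cone_along_blowup[y yv].
exists (blowup_class y) => //; apply: Phi_classE.
exact: cvg_trans (cvg_app _ oo_omega) yv.
Qed.
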